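(* Let $\alpha\in(0,1)$ and let $(T(t))_{t\ge0}$ be a bi-continuous semigroup of negative growth bound with generator $A$ on a triple $(X_0,\|\cdot\|,\tau)$ satisfying Assumption (S) of the context. Then $D(A)$ is $\tau_{F_\alpha}$-bi-dense in $X_\alpha$ (i.e. for each $x\in X_\alpha$ there is a $\|\cdot\|_{F_\alpha}$-bounded sequence in $D(A)$ converging to $x$ in $\tau_{F_\alpha}$) and \[ X_\alpha=\bigl\{x\in F_\alpha:\ \tau_{F_\alpha}\text{-}\lim_{t\to0}T(t)x=x\bigr\}, \] i.e. for $x\in F_\alpha$ the mapping $t\mapsto T(t)x$ is $\tau_{F_\alpha}$-continuous if and only if $x\in X_\alpha$.
   Context: Assumption (S) on a triple $(X_0,\|\cdot\|,\tau)$: $(X_0,\|\cdot\|)$ is a Banach space; (1) $\tau$ is a locally convex Hausdorff topology coarser than the norm topology; (2) $\tau$ is sequentially complete on the closed unit ball; (3) $\|x\|=\sup\{|\varphi(x)|:\varphi\in(X_0,\tau)',\|\varphi\|\le1\}$. Equivalently to (3), there is a set $\mathcal{P}$ of $\tau$-continuous seminorms defining $\tau$ with $\|x\|=\sup_{p\in\mathcal{P}}p(x)$; fix such $\mathcal{P}$. A bi-continuous semigroup on such a triple is a family $(T(t))_{t\ge0}$ in $\mathscr{L}(X_0)$ with: $T(0)=I$, $T(t+s)=T(t)T(s)$; $t\mapsto T(t)x$ $\tau$-continuous for every $x$; $\|T(t)\|\le Me^{\omega t}$ for some $M\ge1$, $\omega\in\mathbb{R}$; and for each norm-bounded $\tau$-null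 sequence $(x_n)$ and $t_0\ge0$, $T(s)x_n\to0$ in $\tau$ uniformly for $s\in[0,t_0]$. Negative growth bound means that $\omega<0$ can be chosen. Generator: $Ax:=\tau\text{-}\lim_{t\to0}\frac{T(t)x-x}{t}$, $D(A):=\{x:\tau\text{-}\lim_{t\to0}\frac{T(t)x-x}{t}\text{ exists and }\sup_{t\in(0,1]}\frac{\|T(t)x-x\|}{t}<\infty\}$. $F_\alpha:=\{x\in X_0:\|x\|_{F_\alpha}<\infty\}$ with $\|x\|_{F_\alpha}:=\sup_{t>0}\frac{\|T(t)x-x\|}{t^\alpha}$. $X_\alpha:=\{x\in F_\alpha:\tau\text{-}\lim_{t\to0}\frac{T(t)x-x}{t^\alpha}=0\}$ with the norm $\|\cdot\|_{F_\alpha}$. $\tau_{F_\alpha}$ is the locally convex topology on $F_\alpha$ (and $X_\alpha$) generated by the seminorms $p_{F_\alpha}(x):=\sup_{t>0}\frac{p(T(t)x-x)}{t^\alpha}$, $p\in\mathcal{P}$. *)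

(* Defs.v *)
From HB Require Import structures.
From mathcomp Require Import all_boot all_order all_algebra.
From mathcomp Require Import complex.
From mathcomp Require Import all_classical all_reals all_analysis.

Set Implicit Arguments.
Unset Strict Implicit.
Unset Printing Implicit Defensive.

Import Order.TTheory GRing.Theory Num.Theory.
Import numFieldNormedType.Exports.

Local Open Scope classical_set_scope.
Local Open Scope ring_scope.

(* The scalar field of the Banach space is either R or R[i].  In both cases
   MathComp norms take their values in the scalar field itself; [abs_R] and
   [normr_R] below are the same norms viewed as elements of R. *)
Variant scalar_kind := RealScalars | ComplexScalars.

Definition scalars (R : realType) (c : scalar_kind) : numFieldType :=
  match c with RealScalars => R | ComplexScalars => R[i]%C end.

Definition of_real (R : realType) (c : scalar_kind) : R -> scalars R c :=
  match c with RealScalars => id | ComplexScalars => real_complex R end.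

Definition real_part (R : realType) (c : scalar_kind) : scalars R c -> R :=
  match c with RealScalars => id | ComplexScalars => @complex.Re R end.

Arguments of_real {R c}.
Arguments real_part {R c}.

Section Defs.
Context {R : realType} {c : scalar_kind}.
Local Notation K := (scalars R c).

Definition abs_R (k : K) : R := real_part `|k|.

Lemma of_real_abs_R (k : K) : of_real (abs_R k) = `|k|.
Proof.
rewrite /abs_R; move: k; case: c => //= k; exact: RRe_real (normr_real k).
Qed.

Definition normr_R {X : normedModType K} (x : X) : R := real_part `|x|.

Lemma of_real_normr_R (X : normedModType K) (x : X) :
  of_real (normr_R x) = `|x|.
Proof.
rewrite /normr_R; have := normr_real x; move: `|x|; clear.
by case: c => //= k /RRe_real.
Qed.

Definition seminorm {X : lmodType K} (p : X -> R) : Prop :=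
  (forall x y, p (x + y) <= p x + p y) /\
  (forall k x, p (k *: x) = abs_R k * p x).

(* Neighbourhoods of x in the topology generated by the family Q of seminorms,
   on the subspace D where all of them are finite. *)
Definition seminorm_nbhs {X : lmodType K} (D : set X) (Q : set (X -> \bar R))
    (x : X) : set_system X :=
  [set U | exists (F : set (X -> \bar R)) (e : R),
    [/\ finite_set F, F `<=` Q, 0 < e &
        [set y | D y /\ forall q, F q -> (q (y - x)%R < e%:E)%E] `<=` U]].

Section Triple.
(* The Banach space (X0, ||.||) is X; Xtau is the same vector space with the
   topology tau, and j : X -> Xtau is the identity. *)
Context {X : completeNormedModType K} {Xtau : tvsType K}.
Variable j : {linear X -> Xtau}.

Definition unit_ball : set X := [set x | `|x| <= 1].

(* [cauchy] is not usable here: the uniformity carried by a [tvsType] is only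
   required to induce the topology, it need not be the one given by the
   translates of the neighbourhoods of 0. *)
Definition tau_cauchy (u : nat -> X) : Prop :=
  (fun mn : nat * nat => j (u mn.1 - u mn.2)) @ (\oo, \oo) --> (0 : Xtau).

Record assumption_S : Prop := {
  S_bij : bijective j ;
  S_hausdorff : hausdorff_space Xtau ;
  S_coarser : continuous j ;
  S_seq_complete : forall u : nat -> X,
    (forall n, unit_ball (u n)) -> tau_cauchy u ->
    exists2 x, unit_ball x & j \o u @ \oo --> j x ;
  S_norming : forall x : X,
    (normr_R x)%:E = ereal_sup
      [set (abs_R (phi (j x)))%:E | phi in
        [set phi : {linear Xtau -> K^o} |
          continuous phi /\ forall y : X, `|phi (j y)| <= `|y|]] }.

(* P is a set of tau-continuous seminorms defining tau and norming X. *)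
Record defining_seminorms (P : set (X -> R)) : Prop := {
  P_seminorm : forall p, P p -> seminorm p ;
  P_continuous : forall p, P p ->
    forall x : X, forall e : R, 0 < e ->
      nbhs (j x) (j @` [set y | `|p y - p x| < e]) ;
  P_defines : forall (x : X) (U : set Xtau),
    nbhs (j x) U <->
    seminorm_nbhs setT [set (EFin \o p) | p in P] x (j @^-1` U) ;
  P_norm : forall x : X, (normr_R x)%:E = ereal_sup [set (p x)%:E | p in P] }.

(* Only the values T t for 0 <= t are meaningful. *)
Variable T : R -> {linear X -> X}.

Definition exp_bounded (M omega : R) : Prop :=
  forall (t : R) x, 0 <= t -> normr_R (T t x) <= M * expR (omega * t) * normr_R x.

Record bicontinuous_semigroup : Prop := {
  sg_0 : forall x, T 0 x = x ;
  sg_D : forall (s t : R) x, 0 <= s -> 0 <= t -> T (t + s) x = T t (T s x) ;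
  sg_continuous : forall x,
    {within [set t : R | 0 <= t], continuous (fun t : R => j (T t x))} ;
  sg_bounded : exists M omega, 1 <= M /\ exp_bounded M omega ;
  sg_local_bi_equicontinuous : forall (u : nat -> X) (t0 : R),
    (exists C, forall n, normr_R (u n) <= C) ->
    j \o u @ \oo --> (0 : Xtau) -> 0 <= t0 ->
    forall U, nbhs (0 : Xtau) U ->
      \forall n \near \oo, forall s : R, 0 <= s <= t0 -> U (j (T s (u n))) }.

Definition negative_growth_bound : Prop :=
  exists M omega, [/\ 1 <= M, omega < 0 & exp_bounded M omega].

(* generator x y means that x is in D(A) and A x = y. *)
Definition generator (x y : X) : Prop :=
  (fun t : R => j (of_real t^-1 *: (T t x - x))) @ 0^'+ --> j y /\
  exists C : R, forall t : R, 0 < t <= 1 -> normr_R (T t x - x) / t <= C.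

Definition generator_domain : set X := [set x | exists y, generator x y].

Variable alpha : R.

(* sup_{t > 0} p (T t x - x) / t^alpha; the norm of F_alpha is the case
   p = normr_R. *)
Definition holder_sup (p : X -> R) (x : X) : \bar R :=
  ereal_sup [set (p (T t x - x) / t `^ alpha)%:E | t in [set t : R | 0 < t]].

Definition F_norm : X -> \bar R := holder_sup normr_R.

Definition F_space : set X := [set x | (F_norm x < +oo)%E].

Definition X_space : set X :=
  [set x | F_space x /\
    (fun t : R => j (of_real (t `^ alpha)^-1 *: (T t x - x))) @ 0^'+
      --> (0 : Xtau)].

Definition tauF_nbhs (P : set (X -> R)) : X -> set_system X :=
  seminorm_nbhs F_space [set holder_sup p | p in P].

Definition tauF_bidense (P : set (X -> R)) (D E : set X) : Prop :=
  D `<=` E /\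
  forall x, E x -> exists u : nat -> X,
    [/\ forall n, D (u n),
        exists C : R, forall n, (F_norm (u n) <= C%:E)%E &
        u @ \oo `=>` tauF_nbhs P x].

Definition tauF_orbit_continuous (P : set (X -> R)) (x : X) : Prop :=
  forall s : R, 0 <= s ->
    (fun t : R => T t x) @ within [set t : R | 0 <= t] (nbhs s)
      `=>` tauF_nbhs P (T s x).

End Triple.
End Defs.

(* Main.v *)
(* A norm-bounded tau-null sequence stays tau-small under the whole semigroup:
   for t in a bounded interval this is local bi-equicontinuity, and for large t
   the operators T t are small in norm since the growth bound is negative.
   Applied to T h x - x this makes orbits uniformly tau-continuous, so that the
   means M_t x = (1/t) int_0^t T s x ds exist as limits of Riemann sums; they
   lie in D(A), with A M_t x = (T t x - x) / t.

   Applied to (T t x - x) / t^alpha for x in X_alpha, it gives T h x -> x in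
   tau_F: for t < d write (T t - 1)(T h x - x) = (T h - 1)(T t x - x), and for
   t >= d bound t^alpha below by d^alpha. As p_F(M_h x - x) is at most the
   supremum of p_F(T s x - x) over s <= h, also M_h x -> x in tau_F, whence
   bi-density. Conversely, if T h x -> x in tau_F then M_h x -> x in tau_F with
   M_h x in D(A), a subset of X_alpha, and the condition defining X_alpha
   passes to such limits. *)
Require Import Defs.
From mathcomp Require Import all_boot all_order all_algebra.
From mathcomp Require Import complex.
From mathcomp Require Import all_classical all_reals all_analysis.
From mathcomp Require Import ring lra.
Import Order.TTheory GRing.Theory Num.Theory.
Import numFieldNormedType.Exports.
Local Open Scope classical_set_scope.
Local Open Scope ring_scope.

Set Implicit Arguments.
Unset Strict Implicit.
Unset Printing Implicit Defensive.

(** * Filters over finite families, and real numbers as scalars *)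

Lemma filter_finite_set {I T : Type} (F : set_system I) (A : set T)
    (Q : T -> I -> Prop) :
  Filter F -> finite_set A -> (forall a, A a -> \forall i \near F, Q a i) ->
  \forall i \near F, forall a, A a -> Q a i.
Proof.
(* Describing [A] by a finite set structure requires choice on [T], which [Pchoice] supplies
   classically. *)
move=> FF finA; elim/Pchoice: T => T in A Q finA *.
case/finite_fsetP: finA => S -> QF.
apply: filterS (filter_bigI (D := S) (f := Q) _ _) => [i Qi a Sa|a aS].
  exact: Qi.
exact: QF.
Qed.

Section Scalars.
Context {R : realType} {c : scalar_kind}.

Lemma abs_R_of_real (a : R) : abs_R (of_real a : scalars R c) = `|a|.
Proof. by rewrite /abs_R; case: c => //=; rewrite expr0n addr0 sqrtr_sqr. Qed.

Lemma abs_R0 : abs_R (0 : scalars R c) = 0.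
Proof. by rewrite /abs_R normr0; case: c. Qed.

Lemma abs_RN1 : abs_R (-1 : scalars R c) = 1.
Proof. by rewrite /abs_R normrN1; case: c. Qed.

Lemma of_realD (a b : R) : of_real (a + b) = of_real a + of_real b :> scalars R c.
Proof. by case: c => //=; rewrite rmorphD. Qed.

Lemma of_realB (a b : R) : of_real (a - b) = of_real a - of_real b :> scalars R c.
Proof. by case: c => //=; rewrite rmorphB. Qed.

Lemma of_realM (a b : R) : of_real (a * b) = of_real a * of_real b :> scalars R c.
Proof. by case: c => //=; rewrite rmorphM. Qed.

Lemma of_real_nat (n : nat) : of_real n%:R = n%:R :> scalars R c.
Proof. by case: c => //=; rewrite rmorph_nat. Qed.

Lemma of_real1 : of_real 1 = 1 :> scalars R c.
Proof. exact: (of_real_nat 1). Qed.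

Lemma ler_of_real (a b : R) : (of_real a <= of_real b :> scalars R c) = (a <= b).
Proof. by case: c => //=; rewrite lecR. Qed.

Lemma normr_R_seminorm (X : normedModType (scalars R c)) :
  seminorm (@normr_R R c X).
Proof.
split=> [x y|k x].
  rewrite -ler_of_real of_realD !of_real_normr_R; exact: ler_normD.
have : of_real (normr_R (k *: x)) = of_real (abs_R k * normr_R x) :> scalars R c.
  by rewrite of_realM of_real_abs_R !of_real_normr_R normrZ.
by case: c X k x => [|] X k x //= /complexI.
Qed.

End Scalars.

(** * Elementary properties of seminorms *)

Section Seminorm.
Context {R : realType} {c : scalar_kind} {X : lmodType (scalars R c)}.
Context {p : X -> R}.
Hypothesis pP : seminorm p.

Lemma seminormD x y : p (x + y) <= p x + p y.
Proof. by case: pP. Qed.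

Lemma seminormZ (a : R) x : p (of_real a *: x) = `|a| * p x.
Proof. by case: pP => _ ->; rewrite abs_R_of_real. Qed.

Lemma seminorm0 : p 0 = 0.
Proof. by rewrite -(scale0r 0); case: pP => _ ->; rewrite abs_R0 mul0r. Qed.

Lemma seminormN x : p (- x) = p x.
Proof. by rewrite -scaleN1r; case: pP => _ ->; rewrite abs_RN1 mul1r. Qed.

Lemma seminorm_ge0 x : 0 <= p x.
Proof. have := seminormD x (- x); rewrite subrr seminorm0 seminormN; lra. Qed.

Lemma seminormB x y : p (x - y) <= p x + p y.
Proof. by rewrite -(seminormN y); exact: seminormD. Qed.

Lemma seminorm_distC x y : p (x - y) = p (y - x).
Proof. by rewrite -seminormN opprB. Qed.

Lemma seminorm_sum (r : R) m n (f : nat -> X) :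
  (forall k, (m <= k < n)%N -> p (f k) <= r) ->
  p (\sum_(m <= k < n) f k) <= (n - m)%:R * r.
Proof.
move=> fr; apply: (@le_trans _ _ (\sum_(m <= k < n) p (f k))).
  rewrite big_seq [leRHS]big_seq.
  by elim/big_ind2: _ => [|x1 x2 y1 y2|//]; [rewrite seminorm0|
    move=> h1 h2; apply: le_trans (seminormD _ _) _; apply: lerD].
rewrite mulr_natl -sumr_const_nat big_nat [leRHS]big_nat.
by apply: ler_sum => k /fr.
Qed.

End Seminorm.

(** * Convergence and completeness for tau, expressed by seminorms *)

Section Topology.
Context {R : realType} {c : scalar_kind}.
Context {X : completeNormedModType (scalars R c)} {Xtau : tvsType (scalars R c)}.
Context {j : {linear X -> Xtau}} {P : set (X -> R)}.
Hypothesis jS : assumption_S j.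
Hypothesis jP : defining_seminorms j P.

(** Since [P] is norming, a norm estimate may be proved one seminorm at a time; this is how bounds
    on tau-limits become norm bounds later. *)
Lemma normr_R_leP x r : (normr_R x <= r) <-> (forall p, P p -> p x <= r).
Proof.
rewrite -lee_fin (P_norm jP); split=> [xr p Pp|xr].
  rewrite -lee_fin; apply: le_trans xr; apply: ereal_sup_ubound.
  by exists p.
by apply: ge_ereal_sup => _ [p Pp <-]; rewrite lee_fin; exact: xr.
Qed.

Lemma le_normr_R p x : P p -> p x <= normr_R x.
Proof. by move=> Pp; exact: (normr_R_leP x (normr_R x)).1. Qed.

(** A basic neighbourhood involves only finitely many seminorms, and a filter is closed under finite
    intersections, so each [p] can be tested separately. *)
Lemma tau_cvgP {I : Type} (F : set_system I) (f : I -> X) (x : X) : Filter F ->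
  ((j \o f) @ F --> j x) <->
  (forall p, P p -> forall e, 0 < e -> \forall i \near F, p (f i - x) < e).
Proof.
move=> FF; split=> [fx p Pp e e0|fx U].
  have : nbhs (j x) (j @` [set y | p (y - x) < e]).
    apply: (P_defines jP x _).2; exists [set EFin \o p], e; split=> //.
    - by move=> _ ->; exists p.
    - by move=> y [_ /(_ _ erefl)]; rewrite lte_fin => ?; exists y.
  move=> /fx/(@filterS _ F); apply=> i [y yx jy].
  by rewrite -(bij_inj (S_bij jS) jy).
move/(P_defines jP x _).1 => [Q [e [finQ QP e0 QU]]].
have : \forall i \near F, forall q, Q q -> (q (f i - x)%R < e%:E)%E.
  apply: filter_finite_set => // q /QP[p Pp <-].
  by apply: filterS (fx p Pp e e0) => i; rewrite lte_fin.
by rewrite nbhs_filterE; apply: filterS => i Qi; apply: (QU (f i)).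
Qed.

Lemma tau_complete (u : nat -> X) C : (forall n, normr_R (u n) <= C) ->
  (forall p, P p -> forall e, 0 < e -> exists N, forall m n,
    (N <= m)%N -> (N <= n)%N -> p (u m - u n) < e) ->
  exists y, forall p, P p -> forall e, 0 < e ->
    \forall n \near \oo, p (u n - y) < e.
Proof.
(* Completeness is assumed on the unit ball only, so the sequence is scaled into it by [a] and its
   limit scaled back. Taking [|C| + 1] keeps the factor positive for every [C]. *)
move=> uC uE; pose a := (`|C| + 1)^-1.
have C0 : 0 < `|C| + 1 by have := normr_ge0 C; lra.
have a0 : 0 < a by rewrite invr_gt0.
have aK (v : X) : v = of_real a^-1 *: (of_real a *: v).
  by rewrite scalerA -of_realM mulVf ?gt_eqF// of_real1 scale1r.
have [||y _ uy] := S_seq_complete jS (u := fun n => of_real a *: u n).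
- move=> n; rewrite /unit_ball/= -of_real_normr_R -of_real1 ler_of_real.
  have := seminormZ (normr_R_seminorm X) a (u n); rewrite /seminorm/= => ->.
  rewrite gtr0_norm// /a mulrC ler_pdivrMr// mul1r.
  by have := uC n; have := ler_norm C; lra.
- rewrite /tau_cauchy -(linear0 j).
  apply: (fun FF => (@tau_cvgP _ (filter_prod \oo \oo)
    (fun mn : nat * nat => of_real a *: u mn.1 - of_real a *: u mn.2) 0 FF).2).
  move=> p Pp e e0; have [N uN] := uE p Pp (e / a) (divr_gt0 e0 a0).
  exists ([set m | (N <= m)%N], [set n | (N <= n)%N]) => /=.
    by split; exact: nbhs_infty_ge.
  move=> [m n]/= [Nm Nn]; rewrite subr0 -scalerBr.
  rewrite (seminormZ (P_seminorm jP Pp)) gtr0_norm// mulrC -ltr_pdivlMr//.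
  exact: uN.
exists (of_real a^-1 *: y) => p Pp e e0.
have /tau_cvgP/(_ p Pp (a * e)) := uy; move=> /(_ (mulr_gt0 a0 e0)).
apply: filterS => n; rewrite [u n]aK -scalerBr -aK.
by rewrite (seminormZ (P_seminorm jP Pp)) gtr0_norm ?invr_gt0// ltr_pdivrMl.
Qed.

End Topology.

(** * Uniform smallness of the semigroup on bounded tau-null families *)

Section Semigroup.
Context {R : realType} {c : scalar_kind}.
Context {X : completeNormedModType (scalars R c)} {Xtau : tvsType (scalars R c)}.
Context {j : {linear X -> Xtau}} {P : set (X -> R)} {T : R -> {linear X -> X}}.
Context {M omega : R}.
Hypothesis jS : assumption_S j.
Hypothesis jP : defining_seminorms j P.
Hypothesis TP : bicontinuous_semigroup j T.
Hypothesis M1 : 1 <= M.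
Hypothesis omega0 : omega < 0.
Hypothesis TM : exp_bounded T M omega.

Let nrm_ge0 (x : X) : 0 <= normr_R x.
Proof. exact: seminorm_ge0 (normr_R_seminorm X) x. Qed.

Lemma normr_R_semigroup t x : 0 <= t -> normr_R (T t x) <= M * normr_R x.
Proof.
move=> t0; apply: le_trans (TM x t0) _; apply: ler_wpM2r => //.
rewrite ler_piMr//; first exact: le_trans M1.
by rewrite -expR0 ler_expR mulr_le0_ge0// ltW.
Qed.

Lemma semigroup_comm s t x : 0 <= s -> 0 <= t -> T t (T s x) = T s (T t x).
Proof. by move=> s0 t0; rewrite -!(sg_D TP)// addrC. Qed.

Lemma nearR0P (Q : R -> Prop) :
  (\forall h \near (0 : R)^'+, Q h) <->
  exists2 d : R, 0 < d & forall h, 0 < h < d -> Q h.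
Proof.
split=> [[d /= d0 dQ]|[d d0 dQ]].
  exists d => // h /andP[h0 hd]; apply: dQ => //=.
  by rewrite sub0r normrN gtr0_norm.
near=> h; apply: dQ; apply/andP; split; near: h.
- exact: nbhs_right_gt.
- exact: nbhs_right_lt.
Unshelve. all: by end_near. Qed.

Lemma semigroup_decay C e : 0 < e -> exists2 t0, 0 <= t0 &
  forall t x, t0 <= t -> normr_R x <= C -> normr_R (T t x) < e.
Proof.
(* With this [t0], M |C| / e <= - omega t < exp (- omega t) for [t >= t0], by the inequality 1 + z
   <= exp z. *)
move=> e0; pose t0 := M * `|C| / e / - omega.
have N0 : 0 < - omega by rewrite oppr_gt0.
have M0 : 0 < M by exact: lt_le_trans M1.
have t00 : 0 <= t0 by rewrite !divr_ge0 ?mulr_ge0// ltW.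
exists t0 => // t x t0t xC; apply: le_lt_trans (TM x (le_trans t00 t0t)) _.
have E : M * `|C| / e < expR (- omega * t).
  apply: (@lt_le_trans _ _ (1 + - omega * t)); last exact: expR_ge1Dx.
  have : M * `|C| / e <= - omega * t by rewrite [leRHS]mulrC -ler_pdivrMr.
  lra.
rewrite mulrAC -[omega * t]opprK -mulNr expRN ltr_pdivrMr ?expR_gt0//.
rewrite [ltRHS]mulrC -ltr_pdivrMr//.
apply: le_lt_trans E; rewrite ler_pM2r ?invr_gt0// ler_pM2l//.
exact: le_trans xC (ler_norm C).
Qed.

Lemma semigroup_uniform_seq (u : nat -> X) C : (forall n, normr_R (u n) <= C) ->
  (forall p, P p -> forall e, 0 < e -> \forall n \near \oo, p (u n) < e) ->
  forall p, P p -> forall e, 0 < e ->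
    \forall n \near \oo, forall t, 0 <= t -> p (T t (u n)) < e.
Proof.
move=> uC u0 p Pp e e0; have [t0 t00 Tt0] := semigroup_decay C e0.
have uj : j \o u @ \oo --> (0 : Xtau).
  rewrite -(linear0 j); apply/(tau_cvgP jS jP) => q Pq r r0.
  by apply: filterS (u0 q Pq r r0) => n; rewrite subr0.
have p0 := seminorm0 (P_seminorm jP Pp).
have U0 : nbhs (0 : Xtau) (j @` [set y | p y < e]).
  rewrite -(linear0 j); apply: filterS (P_continuous jP Pp 0 e0) => _ [y ye <-].
  exists y => //; move: ye => /=; rewrite p0 subr0.
  exact: le_lt_trans (ler_norm _).
have := sg_local_bi_equicontinuous TP (ex_intro _ C uC) uj t00 U0.
apply: filterS => n un t t_ge0; have [tt0|/ltW tt0] := leP t t0.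
  have [|y /= ye /(bij_inj (S_bij jS)) yE] := un t; first by rewrite t_ge0.
  by rewrite -yE.
exact: le_lt_trans (le_normr_R jP _ Pp) (Tt0 _ _ tt0 (uC n)).
Qed.

(** Bi-equicontinuity speaks of sequences. If no [d] worked for the continuous parameter, some
    [h n < 1 / n.+1] would fail for each [n], and the sequence [v (h n)] would contradict the
    preceding lemma. *)
Lemma semigroup_uniform (v : R -> X) C :
  (forall h, 0 < h -> normr_R (v h) <= C) ->
  (forall p, P p -> forall e, 0 < e -> \forall h \near 0^'+, p (v h) < e) ->
  forall p, P p -> forall e, 0 < e ->
    \forall h \near 0^'+, forall t, 0 <= t -> p (T t (v h)) < e.
Proof.
move=> vC v0 p Pp e e0; apply/nearR0P; apply: contrapT => nd.
have /choice[h hP] : forall n, exists h, 0 < h < n.+1%:R^-1 /\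
    ~ forall t, 0 <= t -> p (T t (v h)) < e.
  move=> n; apply: contrapT => nh; apply: nd; exists n.+1%:R^-1 => // h hn.
  by apply: contrapT => ?; apply: nh; exists h.
have : \forall n \near \oo, forall t, 0 <= t -> p (T t (v (h n))) < e.
  apply: (@semigroup_uniform_seq (v \o h) C) => // [n|q Pq r r0].
    by have [/andP[/vC]] := hP n.
  have /nearR0P[d d0 dv] := v0 q Pq r r0.
  apply: filterS (near_infty_natSinv_lt (PosNum d0)) => n /= nd'.
  by have [/andP[h0 hn] _] := hP n; apply: dv; rewrite h0 (lt_trans hn).
by case=> N _ /(_ N (leqnn N)); case: (hP N).
Qed.

Lemma normr_R_semigroupB t x :
  0 <= t -> normr_R (T t x - x) <= (M + 1) * normr_R x.
Proof.
move=> t0; apply: le_trans (seminormB (normr_R_seminorm X) _ _) _.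
by rewrite mulrDl mul1r lerD2r; exact: normr_R_semigroup.
Qed.

(** As T (s + h) x - T s x = T s (T h x - x), this is uniform tau-continuity of the orbit. The value
    [h = 0] is included because grids start at 0. *)
Lemma semigroup_right_continuous x p : P p -> forall e, 0 < e ->
  exists2 d, 0 < d & forall h s, 0 <= h < d -> 0 <= s -> p (T s (T h x - x)) < e.
Proof.
move=> Pp e e0.
have: \forall h \near 0^'+, forall t, 0 <= t -> p (T t (T h x - x)) < e.
  apply: (@semigroup_uniform _ ((M + 1) * normr_R x)) => // [h h0|q Pq r r0].
    by apply: normr_R_semigroupB; exact: ltW.
  have /subspace_continuousP/(_ 0 (lexx 0)) := sg_continuous TP (x := x).
  rewrite /from_subspace /= (sg_0 TP) => /(tau_cvgP jS jP)/(_ q Pq r r0).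
  rewrite near_withinE => -[d /= d0 dT]; apply/nearR0P.
  exists d => // h /andP[h0 hd].
  by apply: dT; [rewrite /= sub0r normrN gtr0_norm|exact: ltW].
move=> /nearR0P[d d0 dT]; exists d => // h s /andP[]; rewrite le_eqVlt.
case/orP=> [/eqP<- _ _|h0 hd]; last by apply: dT; rewrite h0.
by rewrite (sg_0 TP) subrr linear0 (seminorm0 (P_seminorm jP Pp)).
Qed.

(** * Riemann sums of orbits and their convergence *)

(* A Riemann sum for (1/t) int_0^t T s x ds. *)
Definition orbit_average (t : R) (x : X) (l : nat) : X :=
  of_real l%:R^-1 *: \sum_(0 <= k < l) T (t * (k%:R / l%:R)) x.

Let grid_ge0 t k l : 0 <= t -> 0 <= t * (k%:R / l%:R) :> R.
Proof. by move=> t0; rewrite mulr_ge0// divr_ge0. Qed.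

(** Convexity of the ball [p <= e]. For [l = 0] the convention [0^-1 = 0] makes the average 0, which
    is covered by [0 <= e]. *)
Lemma seminorm_average p (f : nat -> X) l e : seminorm p -> 0 <= e ->
  (forall k, (k < l)%N -> p (f k) <= e) ->
  p (of_real l%:R^-1 *: \sum_(0 <= k < l) f k) <= e.
Proof.
move=> pP e0 fe; rewrite (seminormZ pP) ger0_norm ?invr_ge0//.
have [->|l0] := posnP l.
  by rewrite invr0 mul0r.
rewrite mulrC ler_pdivrMr ?ltr0n// mulrC -[X in X%:R * e](subn0 l).
by apply: (seminorm_sum pP) => k; exact: fe.
Qed.

Lemma orbit_average_normr_R t x l : 0 <= t ->
  normr_R (orbit_average t x l) <= M * normr_R x.
Proof.
move=> t0; apply: (seminorm_average (normr_R_seminorm X)) => [|k _].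
  by rewrite mulr_ge0// (le_trans _ M1).
exact/normr_R_semigroup/grid_ge0.
Qed.

(** Both sides are the sum over [0 <= k < l + m]. Rearranged, this trades a shift of the summation
    window by [m] for a comparison of its two ends. *)
Lemma sum_split (V : nmodType) l m (f : nat -> V) :
  \sum_(0 <= k < m) f k + \sum_(m <= k < l + m) f k =
  \sum_(0 <= k < l) f k + \sum_(l <= k < l + m) f k.
Proof. by rewrite -!big_cat_nat ?leq_addr ?leq_addl. Qed.

Lemma average_const l (x : X) : (0 < l)%N ->
  of_real l%:R^-1 *: \sum_(0 <= k < l) x = x.
Proof.
move=> l0; rewrite sumr_const_nat subn0 -[x *+ l]scaler_nat scalerA.
by rewrite -of_real_nat -of_realM mulVf ?pnatr_eq0 -?lt0n// of_real1 scale1r.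
Qed.

Lemma sum_shift (V : nmodType) l m (f : nat -> V) :
  \sum_(m <= k < l + m) f k = \sum_(0 <= k < l) f (m + k)%N.
Proof.
rewrite -{1}[m]add0n big_addn addnK.
by apply: eq_bigr => k _; rewrite addnC.
Qed.

(** The node of index [i * m + k] in the fine grid lies t k / (l m) after the coarse node t i / l.
    The difference is thus a double average of terms T s (T h x - x) with h below the coarse step,
    hence below [d]. *)
Lemma orbit_average_refine p e d t x l m : P p -> 0 <= e -> 0 <= t ->
  (forall h s, 0 <= h < d -> 0 <= s -> p (T s (T h x - x)) < e) ->
  (0 < l)%N -> (0 < m)%N -> t / l%:R < d ->
  p (orbit_average t x (l * m) - orbit_average t x l) <= e.
Proof.
move=> Pp e0 t0 Te l0 m0 tld; have pP := P_seminorm jP Pp.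
have lR0 : l%:R != 0 :> R by rewrite pnatr_eq0 -lt0n.
have mR0 : m%:R != 0 :> R by rewrite pnatr_eq0 -lt0n.
have -> : orbit_average t x (l * m) - orbit_average t x l =
    of_real l%:R^-1 *: \sum_(0 <= i < l) (of_real m%:R^-1 *:
      \sum_(0 <= k < m) T (t * (i%:R / l%:R)) (T (t * (k%:R / (l * m)%:R)) x - x)).
  rewrite /orbit_average -scaler_sumr natrM invfM of_realM -scalerA -scalerBr.
  congr (_ *: _).
  have -> : \sum_(0 <= k < l) T (t * (k%:R / l%:R)) x =
      of_real m%:R^-1 *: \sum_(0 <= i < l) \sum_(0 <= k < m) T (t * (i%:R / l%:R)) x.
    rewrite scaler_sumr; apply: eq_bigr => i _.
    by rewrite average_const.
  rewrite -scalerBr; congr (_ *: _).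
  rewrite big_nat_mul -sumrB; apply: eq_bigr => i _.
  rewrite mulSn sum_shift -sumrB.
  apply: eq_bigr => k _; rewrite linearB -(sg_D TP) ?mulr_ge0 ?divr_ge0 ?invr_ge0//.
  congr (T _ x - _); rewrite addnC natrD !natrM -mulrDr; congr (_ * _).
  by field; apply/andP.
apply: (seminorm_average pP e0) => i _; apply: (seminorm_average pP e0) => k km.
apply/ltW/Te; last exact: grid_ge0.
rewrite grid_ge0//=; apply: le_lt_trans tld; apply: ler_wpM2l => //.
rewrite natrM invfM mulrCA ler_piMr ?invr_ge0//.
by rewrite ler_pdivrMr ?ltr0n// mul1r ler_nat ltnW.
Qed.

(** Two averages are compared through their common refinement, which gives a Cauchy sequence; it is
    norm-bounded, so [tau_complete] applies. *)
Lemma orbit_average_cvg t x : 0 <= t -> exists y,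
  forall p, P p -> forall e, 0 < e ->
    \forall n \near \oo, p (orbit_average t x n.+1 - y) < e.
Proof.
move=> t0; apply: (tau_complete jS jP (u := fun n => orbit_average t x n.+1)).
  by move=> n; exact: orbit_average_normr_R.
move=> p Pp e e0; have pP := P_seminorm jP Pp.
have e30 : 0 < e / 3 by rewrite divr_gt0.
have [d d0 dT] := semigroup_right_continuous x Pp e30.
(* From this index on, [t / d < k.+1], so the grid step [t / k.+1] is below [d]. *)
exists (Num.trunc (t / d)) => m n Nm Nn.
have Nd k : (Num.trunc (t / d) <= k)%N -> t / k.+1%:R < d.
  move=> Nk; rewrite ltr_pdivrMr ?ltr0n// mulrC -ltr_pdivrMr//.
  have /truncn_itv/andP[_] : 0 <= t / d by rewrite divr_ge0// ltW.
  by move=> /lt_le_trans; apply; rewrite ler_nat.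
have := @orbit_average_refine p (e / 3) d t x m.+1 n.+1 Pp (ltW e30) t0 dT isT isT
  (Nd _ Nm).
have := @orbit_average_refine p (e / 3) d t x n.+1 m.+1 Pp (ltW e30) t0 dT isT isT
  (Nd _ Nn).
rewrite (mulnC n.+1) (seminorm_distC pP _ (orbit_average t x m.+1)).
set w := orbit_average t x (m.+1 * n.+1) => h1 h2.
rewrite -[X in p X](subrKA w); apply: le_lt_trans (seminormD pP _ _) _; lra.
Qed.

(** * Means of orbits: increments, and membership in the domain of the generator *)

(** [y] is the tau-limit (1/t) int_0^t T s x ds. A relation is used instead of a chosen limit; the
    index [n.+1] skips the empty average. *)
Definition orbit_mean (t : R) (x y : X) : Prop :=
  forall p, P p -> forall e, 0 < e ->
    \forall n \near \oo, p (orbit_average t x n.+1 - y) < e.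

(** [T r] is not assumed tau-continuous. However, the averages minus [y] form a norm-bounded
    tau-null sequence, on which [T r] is tau-small, so estimates for averages pass to the mean. *)
Lemma orbit_mean_le t x y r w p B : 0 <= t -> 0 <= r ->
  orbit_mean t x y -> P p ->
  (forall e, 0 < e -> \forall n \near \oo,
    p (T r (orbit_average t x n.+1) - orbit_average t x n.+1 - w) <= B + e) ->
  p (T r y - y - w) <= B.
Proof.
move=> t0 r0 xy Pp xB; have pP := P_seminorm jP Pp.
apply/ler_addgt0Pl => e e0; have e30 : 0 < e / 3 by rewrite divr_gt0.
pose u n := orbit_average t x n.+1 - y.
have uC n : normr_R (u n) <= M * normr_R x + normr_R y.
  apply: le_trans (seminormB (normr_R_seminorm X) _ _) _.
  by rewrite lerD2r orbit_average_normr_R.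
have [n [[un Tun] xn]] : exists n, (p (u n) < e / 3 /\
    (forall t, 0 <= t -> p (T t (u n)) < e / 3)) /\
    p (T r (orbit_average t x n.+1) - orbit_average t x n.+1 - w) <= B + e / 3.
  near \oo => n; exists n; split; [split|]; near: n.
  - exact: xy.
  - exact: (semigroup_uniform_seq uC xy).
  - exact: xB.
have -> : T r y - y - w = (T r (orbit_average t x n.+1) - orbit_average t x n.+1 - w)
    - (T r (u n) - u n).
  set a := orbit_average _ _ _.
  have -> : T r (u n) - u n = (T r a - a) - (T r y - y).
    by rewrite /u linearB /= !opprD !opprK addrACA.
  by rewrite [RHS]addrAC subKr.
apply: le_trans (seminormB pP _ _) _.
have := seminormB pP (T r (u n)) (u n); have := Tun r r0; lra.
Unshelve. all: by end_near. Qed.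

(** Discrete form of T r y - y = (1/t) int_0^r T s (T t x - x) ds, where the integrand is compared
    with a constant vector [w]. *)
Lemma orbit_average_increment p t x r w B e d l : P p -> 0 < t -> 0 <= r ->
  0 <= B -> 0 <= e ->
  (forall h s, 0 <= h < d -> 0 <= s -> p (T s (T h x - x)) < e) ->
  (forall s, 0 <= s <= r -> p (T s (T t x - x) - w) <= B) ->
  (0 < l)%N -> t / l%:R < d ->
  p (T r (orbit_average t x l) - orbit_average t x l - of_real (r / t) *: w) <=
  e + r / t * B + p w / l%:R.
Proof.
move=> Pp t0 r0 B0 e0 Te zw l0 tld; have pP := P_seminorm jP Pp.
have lR : 0 < l%:R :> R by rewrite ltr0n.
have lR0 : l%:R != 0 :> R by rewrite gt_eqF.
have tl0 : 0 < t / l%:R by rewrite divr_gt0.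
have t_ge0 := ltW t0.
(* [m] is the number of whole grid steps contained in [r], and [q] below is the remainder. *)
pose m := Num.trunc (r / (t / l%:R)).
have [mr rm] : m%:R * (t / l%:R) <= r /\ r < (m%:R + 1) * (t / l%:R).
  have /truncn_itv/andP[] : 0 <= r / (t / l%:R) by rewrite divr_ge0// ltW.
  by rewrite -/m -natr1 ler_pdivlMr// ltr_pdivrMr.
pose g k := T (t * (k%:R / l%:R)) x.
pose q := r - m%:R * (t / l%:R).
have q0 : 0 <= q by rewrite subr_ge0.
have qd : q < d by apply: lt_trans tld; rewrite /q; lra.
have mlr : m%:R / l%:R <= r / t by rewrite ler_pdivlMr// mulrAC -mulrA.
have rml : r / t <= m%:R / l%:R + l%:R^-1.
  rewrite ler_pdivrMr// ltW//; apply: lt_le_trans rm _; rewrite le_eqVlt.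
  by apply/orP; left; apply/eqP; field.
(* The three terms are the effect of the remainder [q] (at most [e]), the [m] nodes that survive the
   shift (at most [r / t * B]), and the rounding of [r / t] to [m / l] (at most [p w / l]). *)
have -> : T r (orbit_average t x l) - orbit_average t x l - of_real (r / t) *: w =
    of_real l%:R^-1 *: (\sum_(0 <= k < l) T (t * ((m + k)%:R / l%:R)) (T q x - x)) +
    of_real l%:R^-1 *: (\sum_(0 <= k < m) (T (t * (k%:R / l%:R)) (T t x - x) - w)) +
    of_real (m%:R / l%:R - r / t) *: w.
  rewrite -[orbit_average t x l]/(of_real l%:R^-1 *: \sum_(0 <= k < l) g k).
  rewrite linearZ_LR linear_sum /= -scalerBr -scalerDr.
  have -> : \sum_(0 <= k < l) T (t * ((m + k)%:R / l%:R)) (T q x - x) =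
      \sum_(0 <= k < l) T r (g k) - \sum_(m <= k < l + m) g k.
    rewrite sum_shift -sumrB; apply: eq_bigr => k _.
    rewrite linearB /g -!(sg_D TP) ?grid_ge0//; congr (T _ x - _).
    by rewrite /q natrD; ring.
  have -> : \sum_(0 <= k < m) (T (t * (k%:R / l%:R)) (T t x - x) - w) =
      \sum_(l <= k < l + m) g k - \sum_(0 <= k < m) g k - of_real m%:R *: w.
    rewrite addnC sum_shift -sumrB [LHS]sumrB sumr_const_nat subn0.
    rewrite of_real_nat scaler_nat; congr (_ - _); apply: eq_bigr => k _.
    rewrite linearB /g -!(sg_D TP) ?grid_ge0//; congr (T _ x - _).
    by rewrite natrD; field.
  have -> : \sum_(l <= k < l + m) g k - \sum_(0 <= k < m) g k =
      \sum_(m <= k < l + m) g k - \sum_(0 <= k < l) g k.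
    by apply/eqP; rewrite subr_eq addrAC eq_sym subr_eq addrC sum_split addrC.
  rewrite [in RHS]addrA subrKA [in RHS]scalerBr scalerA -of_realM.
  by rewrite [(l%:R^-1 * m%:R)]mulrC of_realB scalerBl addrA subrK.
apply: le_trans (seminormD pP _ _) _; apply: lerD.
  apply: le_trans (seminormD pP _ _) _; apply: lerD.
    apply: (seminorm_average pP e0) => k _.
    by apply/ltW/Te; [rewrite q0|exact: grid_ge0].
  rewrite (seminormZ pP) gtr0_norm ?invr_gt0// mulrC ler_pdivrMr//.
  apply: le_trans (seminorm_sum pP (r := B) _) _.
    move=> k /= km; apply: zw; rewrite grid_ge0//=; apply: le_trans mr.
    by rewrite mulrCA ler_pM2r// ler_nat ltnW.
  by rewrite subn0 mulrAC ler_wpM2r// -ler_pdivrMr.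
rewrite (seminormZ pP) mulrC; apply: ler_wpM2l; first exact: seminorm_ge0.
rewrite ler_norml; lra.
Qed.

(** Letting the grid step tend to 0 removes the first and last error terms. The choice [w = 0]
    yields a Lipschitz bound, and [w = T t x - x] the derivative at 0. *)
Lemma orbit_mean_increment p t x y r w B : orbit_mean t x y -> P p ->
  0 < t -> 0 <= r -> 0 <= B ->
  (forall s, 0 <= s <= r -> p (T s (T t x - x) - w) <= B) ->
  p (T r y - y - of_real (r / t) *: w) <= r / t * B.
Proof.
move=> xy Pp t0 r0 B0 zw; apply: (orbit_mean_le (ltW t0) r0 xy Pp) => e e0.
have pw0 := seminorm_ge0 (P_seminorm jP Pp) w.
have e20 : 0 < e / 2 by rewrite divr_gt0.
have [d d0 dT] := semigroup_right_continuous x Pp e20.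
have dt0 : 0 < d / t by rewrite divr_gt0.
(* Adding 1 avoids a division by zero when [p w = 0]. *)
have ew0 : 0 < e / 2 / (p w + 1) by rewrite divr_gt0// ltr_wpDl.
near=> n.
have n1 : n.+1%:R^-1 < d / t by near: n; exact: (near_infty_natSinv_lt (PosNum dt0)).
have n2 : n.+1%:R^-1 < e / 2 / (p w + 1).
  by near: n; exact: (near_infty_natSinv_lt (PosNum ew0)).
have tn : t / n.+1%:R < d by rewrite mulrC -ltr_pdivlMr.
apply: le_trans (orbit_average_increment Pp t0 r0 B0 (ltW e20) dT zw _ tn) _ => //.
suff : p w / n.+1%:R <= e / 2 by move: (r / t * B) (p w / _) => a b; lra.
rewrite ltr_pdivlMr in n2; last by lra.
apply: le_trans (ltW n2); rewrite mulrC ler_pM2l ?invr_gt0//; lra.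
Unshelve. all: by end_near. Qed.

Lemma orbit_mean_normr_R t x y r : orbit_mean t x y -> 0 < t -> 0 <= r ->
  normr_R (T r y - y) <= r / t * (M * normr_R (T t x - x)).
Proof.
move=> xy t0 r0; apply/(normr_R_leP jP) => p Pp.
have := @orbit_mean_increment p t x y r 0 (M * normr_R (T t x - x)) xy Pp t0 r0.
rewrite scaler0 subr0; apply; first by rewrite mulr_ge0// (le_trans _ M1).
move=> s /andP[s0 _]; rewrite subr0.
exact: le_trans (le_normr_R jP _ Pp) (normr_R_semigroup _ s0).
Qed.

Lemma orbit_mean_generator t x y : 0 < t -> orbit_mean t x y ->
  generator j T y (of_real t^-1 *: (T t x - x)).
Proof.
move=> t0 xy; split; last first.
  exists (M * normr_R (T t x - x) / t) => r /andP[r0 _].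
  rewrite ler_pdivrMr//; apply: le_trans (orbit_mean_normr_R xy t0 (ltW r0)) _.
  by rewrite le_eqVlt; apply/orP; left; apply/eqP; ring.
apply/(tau_cvgP jS jP) => p Pp e e0; have pP := P_seminorm jP Pp.
(* The increment bound multiplies this tolerance by [r / t], giving e r / 2 < e r. *)
have et0 : 0 < e * t / 2 by rewrite divr_gt0// mulr_gt0.
have [d d0 dT] := semigroup_right_continuous (T t x - x) Pp et0.
apply/nearR0P; exists d => // r /andP[r0 rd].
have -> : of_real r^-1 *: (T r y - y) - of_real t^-1 *: (T t x - x) =
    of_real r^-1 *: (T r y - y - of_real (r / t) *: (T t x - x)).
  by rewrite [RHS]scalerBr scalerA -of_realM mulrA mulVf ?gt_eqF// mul1r.
rewrite (seminormZ pP) gtr0_norm ?invr_gt0// mulrC ltr_pdivrMr//.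
apply: le_lt_trans (orbit_mean_increment xy Pp t0 (ltW r0) (ltW et0) _) _.
  move=> s /andP[s0 sr]; have := dT s 0; rewrite s0 (le_lt_trans sr rd) (sg_0 TP).
  by move=> /(_ isT (lexx 0))/ltW.
rewrite [ltLHS](_ : _ = e * r / 2); last by field; rewrite gt_eqF.
by rewrite ltr_pdivrMr//; have := mulr_gt0 e0 r0; lra.
Qed.

(** [T s] commutes with averaging: T s y - y is a limit of averages of T r (T s x - x). *)
Lemma orbit_mean_semigroupB p t x y s B : orbit_mean t x y -> P p ->
  0 <= t -> 0 <= s -> 0 <= B ->
  (forall r, 0 <= r <= t -> p (T r (T s x - x)) <= B) ->
  p (T s y - y) <= B.
Proof.
move=> xy Pp t0 s0 B0 xB; have pP := P_seminorm jP Pp.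
rewrite -[T s y - y]subr0; apply: (orbit_mean_le t0 s0 xy Pp) => e e0.
apply: nearW => n; rewrite subr0.
apply: (@le_trans _ _ B); last by rewrite lerDl ltW.
rewrite /orbit_average linearZ_LR linear_sum /= -scalerBr -sumrB.
apply: (seminorm_average pP B0) => k kn.
rewrite (semigroup_comm _ (grid_ge0 _ _ t0) s0) -linearB; apply: xB.
rewrite grid_ge0//= ler_piMr// ler_pdivrMr ?ltr0n// mul1r ler_nat.
exact: ltnW.
Qed.

Lemma orbit_mean_distance p t x y s B : orbit_mean t x y -> P p ->
  0 <= t -> 0 <= s -> 0 <= B ->
  (forall r, 0 <= r <= t -> p (T s (T r x - x) - (T r x - x)) <= B) ->
  p (T s (y - x) - (y - x)) <= B.
Proof.
move=> xy Pp t0 s0 B0 xB; have pP := P_seminorm jP Pp.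
have -> : T s (y - x) - (y - x) = T s y - y - (T s x - x).
  by rewrite linearB /= !opprD !opprK addrACA.
apply: (orbit_mean_le t0 s0 xy Pp) => e e0.
apply: nearW => n; apply: (@le_trans _ _ B); last by rewrite lerDl ltW.
rewrite /orbit_average linearZ_LR linear_sum /= -scalerBr -sumrB.
(* The constant is written as an average over the same nodes, so that the difference can be taken
   term by term. *)
rewrite -[T s x - x](@average_const n.+1)// -scalerBr -sumrB.
apply: (seminorm_average pP B0) => k kn.
rewrite [X in p X](_ : _ = T s (T (t * (k%:R / n.+1%:R)) x - x) -
    (T (t * (k%:R / n.+1%:R)) x - x)); last first.
  by rewrite [T s (_ - x)]linearB /= !opprD !opprK addrACA.
apply: xB; rewrite grid_ge0//= ler_piMr// ler_pdivrMr ?ltr0n// mul1r ler_nat.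
exact: ltnW.
Qed.

(** * The Hölder spaces F_alpha and X_alpha *)

Section Holder.
Context {alpha : R}.
Hypothesis alpha01 : 0 < alpha < 1.

Lemma holder_sup_leP (p : X -> R) x r : (holder_sup T alpha p x <= r%:E)%E <->
  forall t, 0 < t -> p (T t x - x) <= r * t `^ alpha.
Proof.
split=> [xr t t0|xr].
  rewrite -ler_pdivrMr ?powR_gt0// -lee_fin; apply: le_trans xr.
  by apply: ereal_sup_ubound; exists t.
apply: ge_ereal_sup => _ [t /= t0 <-].
by rewrite lee_fin ler_pdivrMr ?powR_gt0// xr.
Qed.

Lemma F_spaceP x : F_space T alpha x <->
  exists C, forall t, 0 < t -> normr_R (T t x - x) <= C * t `^ alpha.
Proof.
rewrite /F_space /=; split=> [xF|[C /holder_sup_leP]]; last first.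
  by move=> xC; apply: le_lt_trans xC _; exact: ltry.
suff [C xC] : exists C, (F_norm T alpha x <= C%:E)%E.
  by exists C; apply/holder_sup_leP.
(* The value [-oo] needs no refutation, since any constant bounds it. *)
by case: (F_norm T alpha x) xF => // [C _|_]; [exists C|exists 0; exact: leNye].
Qed.

Lemma X_spaceP x : X_space j T alpha x <-> F_space T alpha x /\
  forall p, P p -> forall e, 0 < e ->
    \forall t \near 0^'+, p (T t x - x) <= e * t `^ alpha.
Proof.
have E p t : P p -> 0 < t ->
    p (of_real (t `^ alpha)^-1 *: (T t x - x) - 0) = p (T t x - x) / t `^ alpha.
  move=> Pp t0; rewrite subr0 (seminormZ (P_seminorm jP Pp)).
  by rewrite gtr0_norm ?invr_gt0 ?powR_gt0// mulrC.
rewrite /X_space /= -(linear0 j); split=> -[xF h]; split=> //.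
  move=> p Pp e e0; have /(tau_cvgP jS jP)/(_ p Pp e e0) := h.
  have : \forall t \near (0 : R)^'+, 0 < t by exact: nbhs_right_gt.
  apply: filterS2 => t t0; rewrite E// ltr_pdivrMr ?powR_gt0// => /ltW; exact.
apply/(tau_cvgP jS jP) => p Pp e e0.
have e20 : 0 < e / 2 by rewrite divr_gt0.
have : \forall t \near (0 : R)^'+, 0 < t by exact: nbhs_right_gt.
apply: filterS2 (h p Pp _ e20) => t xt t0.
rewrite E// ltr_pdivrMr ?powR_gt0//; apply: le_lt_trans xt _.
by rewrite ltr_pM2r ?powR_gt0//; lra.
Qed.

(** Basic neighbourhoods consist of points of [F_space], whence the side condition on [f]. *)
Lemma tauF_cvgP {I : Type} (F : set_system I) (f : I -> X) x : Filter F ->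
  (\forall i \near F, F_space T alpha (f i)) ->
  (f @ F `=>` tauF_nbhs T alpha P x) <->
  (forall p, P p -> forall e, 0 < e -> \forall i \near F, forall t, 0 < t ->
    p (T t (f i - x) - (f i - x)) <= e * t `^ alpha).
Proof.
move=> FF fF; split=> [fx p Pp e e0|fx U [Q [e [finQ QP e0 QU]]]].
  pose U := [set y | F_space T alpha y /\ (holder_sup T alpha p (y - x)%R < e%:E)%E].
  have /fx : tauF_nbhs T alpha P x U.
    exists [set holder_sup T alpha p], e; split=> //.
    - by move=> _ ->; exists p.
    - by move=> y [yF ye]; split=> //; exact: ye.
  by apply: (@filterS _ F) => i [_ /ltW/holder_sup_leP].
(* Half of [e] leaves room for the strict inequality after taking the supremum over [t]. *)
have e20 : 0 < e / 2 by rewrite divr_gt0.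
have : \forall i \near F, forall q, Q q -> (q (f i - x)%R < e%:E)%E.
  apply: filter_finite_set => // q /QP[p Pp <-].
  apply: filterS (fx p Pp _ e20) => i /holder_sup_leP fi.
  by apply: le_lt_trans fi _; rewrite lte_fin; lra.
move=> fQ; apply: (@filterS2 _ F _ _ _ _ _ fF fQ) => i iF iQ.
exact: QU.
Qed.

Lemma F_space_semigroup s x : 0 <= s -> F_space T alpha x ->
  F_space T alpha (T s x).
Proof.
move=> s0 /F_spaceP[C xC]; apply/F_spaceP; exists (M * C) => t t0.
rewrite (semigroup_comm _ s0 (ltW t0)) -linearB -mulrA.
apply: le_trans (normr_R_semigroup _ s0) _.
by apply: ler_wpM2l (xC t t0); exact: le_trans M1.
Qed.

(** The extra factor [T s] lets the same estimate serve at every time [s] of the orbit, not only at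
    0. *)
Lemma X_space_orbit x p : X_space j T alpha x -> P p -> forall e, 0 < e ->
  exists2 d, 0 < d & forall h s t, 0 <= h < d -> 0 <= s -> 0 < t ->
    p (T t (T s (T h x - x)) - T s (T h x - x)) <= e * t `^ alpha.
Proof.
move=> /X_spaceP[/F_spaceP[C xC] x0] Pp e e0.
have pP := P_seminorm jP Pp.
pose v t := of_real (t `^ alpha)^-1 *: (T t x - x).
have e20 : 0 < e / 2 by rewrite divr_gt0.
have : \forall h \near 0^'+, forall t, 0 <= t -> p (T t (v h)) < e / 2.
  apply: (@semigroup_uniform v C) => // [h h0|q Pq r r0].
    rewrite /v (seminormZ (normr_R_seminorm X)) gtr0_norm ?invr_gt0 ?powR_gt0//.
    by rewrite mulrC ler_pdivrMr ?powR_gt0// xC.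
  have r20 : 0 < r / 2 by rewrite divr_gt0.
  have : \forall t \near (0 : R)^'+, 0 < t by exact: nbhs_right_gt.
  apply: filterS2 (x0 q Pq _ r20) => t xt t0.
  rewrite /v (seminormZ (P_seminorm jP Pq)) gtr0_norm ?invr_gt0 ?powR_gt0//.
  rewrite mulrC ltr_pdivrMr ?powR_gt0//; apply: le_lt_trans xt _.
  by rewrite ltr_pM2r ?powR_gt0//; lra.
move=> /nearR0P[d d0 vd].
have small s t : 0 <= s -> 0 < t < d -> p (T s (T t x - x)) <= e / 2 * t `^ alpha.
  move=> s0 /andP[t0 td]; rewrite -ler_pdivrMr ?powR_gt0// ltW//.
  have := vd t; rewrite t0 td => /(_ isT s s0); rewrite /v linearZ_LR.
  by rewrite (seminormZ pP) gtr0_norm ?invr_gt0 ?powR_gt0// mulrC.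
(* [d] is already fixed, so the tolerance may depend on it; for [t >= d] it is absorbed by d^alpha
   <= t^alpha. *)
have dr0 : 0 < e / 2 * d `^ alpha by rewrite mulr_gt0// powR_gt0.
have [d' d'0 Td'] := semigroup_right_continuous x Pp dr0.
exists d' => // h s t hd' s0 t0; have /andP[h0 _] := hd'.
have t_ge0 := ltW t0; case: (ltP t d) => td.
  have -> : T t (T s (T h x - x)) - T s (T h x - x)
          = T (s + h) (T t x - x) - T s (T t x - x).
    rewrite (semigroup_comm _ s0 t_ge0) -linearB (sg_D TP)// -linearB.
    congr (T s _); rewrite !linearB (semigroup_comm _ h0 t_ge0)/=.
    by rewrite addrACA.
  apply: le_trans (seminormB pP _ _) _.
  rewrite [e]splitr mulrDl; apply: lerD; apply: small; rewrite ?addr_ge0 ?t0//.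
rewrite -(sg_D TP)//.
apply: le_trans (seminormB pP _ _) _.
apply: (@le_trans _ _ (e * d `^ alpha)).
  rewrite [e]splitr mulrDl; apply: lerD; apply/ltW/Td' => //.
  exact: addr_ge0.
by rewrite ler_pM2l// ge0_ler_powR// ?nnegrE ltW//; case/andP: alpha01.
Qed.

(** The Lipschitz bound in the definition of D(A) controls t <= 1, where t <= t^alpha; for t > 1
    boundedness of the semigroup and t^alpha >= 1 suffice. *)
Lemma generator_domain_X_space :
  generator_domain j T `<=` X_space j T alpha.
Proof.
move=> x [y [_ [C xC]]]; have [a0 a1] := andP alpha01.
have xC1 t : 0 < t <= 1 -> normr_R (T t x - x) <= C * t.
  by move=> /[dup] t01 /xC; rewrite ler_pdivrMr//; case/andP: t01.
have C0 : 0 <= C.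
  by apply: le_trans (xC 1 _); rewrite ?divr1// ltr01 lexx.
apply/X_spaceP; split.
  apply/F_spaceP; exists (C + (M + 1) * normr_R x) => t t0.
  have nx0 : 0 <= (M + 1) * normr_R x.
    by rewrite mulr_ge0// addr_ge0// (le_trans _ M1).
  have [t1|/ltW t1] := leP t 1.
    apply: le_trans (xC1 t _) _; first by rewrite t0.
    apply: ler_pM => //; [exact: ltW|by rewrite lerDl|].
    by rewrite ger1_powR ?t0// ltW.
  apply: le_trans (normr_R_semigroupB _ (ltW t0)) _.
  rewrite -[leLHS]mulr1; apply: ler_pM => //; first by rewrite lerDr.
  by rewrite -(powRr0 t); apply: ler_powR => //; exact: ltW.
move=> p Pp e e0.
have C1 : 0 < C + 1 by rewrite ltr_wpDl.
have eC : 0 < e / (C + 1) by rewrite divr_gt0.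
have a10 : 0 < 1 - alpha by rewrite subr_gt0.
near=> t.
have t0 : 0 < t by near: t; exact: nbhs_right_gt.
have t1 : t <= 1 by near: t; exact: nbhs_right_le.
have ta : t `^ (1 - alpha) <= e / (C + 1).
  rewrite -[leLHS]ger0_norm ?powR_ge0// ltW//; near: t.
  by have /cvgr0Pnorm_lt/(_ _ eC) := powR_cvg0 a10.
apply: le_trans (le_normr_R jP _ Pp) _.
apply: le_trans (xC1 t _) _; first by rewrite t0.
(* Splitting off t^(1 - alpha), which tends to 0, gives the little-o condition of X_alpha. *)
have tE : t = t `^ (1 - alpha) * t `^ alpha.
  by rewrite -powRD ?(gt_eqF t0) ?implybT// subrK powRr1 ?ltW.
rewrite {1}tE mulrA ler_wpM2r ?powR_ge0//.
apply: le_trans (ler_wpM2l C0 ta) _.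
rewrite mulrA ler_pdivrMr// mulrC ler_pM2l//; lra.
Unshelve. all: by end_near. Qed.

(** The mean is a tau-limit, so the norm bound is obtained for each [p] and recombined. The factor
    [M] bounds the operators [T r] being averaged. *)
Lemma orbit_mean_holder t x y C : orbit_mean t x y -> 0 <= t ->
  (forall s, 0 < s -> normr_R (T s x - x) <= C * s `^ alpha) ->
  forall s, 0 < s -> normr_R (T s y - y) <= M * C * s `^ alpha.
Proof.
move=> xy t0 xC s s0; apply/(normr_R_leP jP) => p Pp.
have M0 : 0 <= M by exact: le_trans M1.
rewrite -mulrA; apply: le_trans (ler_wpM2l M0 (xC s s0)).
apply: (orbit_mean_semigroupB xy Pp t0 (ltW s0)) => [|r /andP[r0 _]].
  exact: mulr_ge0.
exact: le_trans (le_normr_R jP _ Pp) (normr_R_semigroup _ r0).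
Qed.

(** For s <= t the difference is T s (T (t - s) x - x), and the claim is symmetric in s and t. The
    case s = 0 serves density, the general one continuity of orbits. *)
Lemma X_space_orbit_uniform x p : X_space j T alpha x -> P p ->
  forall e, 0 < e -> exists2 d, 0 < d & forall s t r,
    0 <= s -> 0 <= t -> `|t - s| < d -> 0 < r ->
    p (T r (T t x - T s x) - (T t x - T s x)) <= e * r `^ alpha.
Proof.
move=> xX Pp e e0; have [d d0 dx] := X_space_orbit xX Pp e0.
exists d => // s t r; wlog st : s t / s <= t => [ih|] s0 t0 std r0.
  have [st|/ltW ts] := leP s t; first exact: ih.
  rewrite -(seminormN (P_seminorm jP Pp)) opprB -[T t x - T s x]opprB.
  by rewrite linearN opprK addrC; apply: ih => //; rewrite distrC.
have ts0 : 0 <= t - s by rewrite subr_ge0.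
have -> : T t x - T s x = T s (T (t - s) x - x).
  by rewrite linearB /= -(sg_D TP)// [s + _]addrC subrK.
by apply: dx => //; rewrite ts0 -(ger0_norm ts0).
Qed.

(** * Bi-density, and X_alpha characterised by continuity of orbits *)

Lemma X_space_bidense :
  tauF_bidense T alpha P (generator_domain j T) (X_space j T alpha).
Proof.
split; first exact: generator_domain_X_space.
move=> x xX; have [/F_spaceP[C xC] _] := (X_spaceP x).1 xX.
have ninv0 n : 0 < n.+1%:R^-1 :> R by rewrite invr_gt0 ltr0n.
(* The approximating sequence consists of the means over [[0, 1 / n.+1]]. *)
have /choice[u xu] n : exists y, orbit_mean n.+1%:R^-1 x y.
  exact/orbit_average_cvg/ltW.
have uC n t : 0 < t -> normr_R (T t (u n) - u n) <= M * C * t `^ alpha.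
  by apply: orbit_mean_holder (xu n) _ xC _; exact: ltW.
exists u; split.
- by move=> n; exists (of_real (n.+1%:R^-1)^-1 *: (T n.+1%:R^-1 x - x));
    exact: orbit_mean_generator.
- by exists (M * C) => n; apply/holder_sup_leP => t; exact: uC.
apply/tauF_cvgP.
  by apply: nearW => n; apply/F_spaceP; exists (M * C) => t; exact: uC.
move=> p Pp e e0; have [d d0 dx] := X_space_orbit_uniform xX Pp e0.
apply: filterS (near_infty_natSinv_lt (PosNum d0)) => n /= nd t t0.
apply: (orbit_mean_distance (xu n) Pp (ltW (ninv0 n)) (ltW t0)) => [|r].
  by rewrite mulr_ge0 ?powR_ge0// ltW.
move=> /andP[r0 rn]; have := dx 0 r t (lexx 0) r0; rewrite (sg_0 TP).
by apply=> //; rewrite subr0 ger0_norm// (le_lt_trans rn).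
Qed.

Lemma X_space_tauF_orbit_continuous x : X_space j T alpha x ->
  tauF_orbit_continuous T alpha P x.
Proof.
move=> xX s s0; have [xF _] := (X_spaceP x).1 xX.
apply/tauF_cvgP.
  by near=> t; apply: F_space_semigroup => //; near: t; exact: withinT.
move=> p Pp e e0; have [d d0 dx] := X_space_orbit_uniform xX Pp e0.
rewrite near_withinE; exists d => // t /= std t0 r r0.
by apply: dx => //; rewrite distrC.
Unshelve. all: by end_near. Qed.

Lemma tauF_orbit_continuous_cvg0 x : tauF_orbit_continuous T alpha P x ->
  (fun t : R => T t x) @ 0^'+ `=>` tauF_nbhs T alpha P x.
Proof.
move=> /(_ 0 (lexx 0)); rewrite (sg_0 TP) => x0 U /x0 xU.
have {}xU : \forall t \near within [set t | 0 <= t] (nbhs (0 : R)), U (T t x) := xU.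
change (\forall t \near (0 : R)^'+, U (T t x)); move: xU; rewrite !near_withinE.
by apply: filterS => t tU t0; apply: tU; exact: ltW.
Qed.

Lemma tauF_cvg0_X_space x : F_space T alpha x ->
  (fun t : R => T t x) @ 0^'+ `=>` tauF_nbhs T alpha P x -> X_space j T alpha x.
Proof.
move=> xF; have xFt : \forall t \near (0 : R)^'+, F_space T alpha (T t x).
  apply/nearR0P; exists 1 => // t /andP[t0 _].
  by apply: F_space_semigroup => //; exact: ltW.
move=> /(tauF_cvgP _ _ xFt) x0; apply/X_spaceP; split=> // p Pp e e0.
have e20 : 0 < e / 2 by rewrite divr_gt0.
have pP := P_seminorm jP Pp.
have /nearR0P[d d0 dx] : \forall h \near (0 : R)^'+, forall t, 0 < t ->
    p (T t (T h x - x) - (T h x - x)) <= e / 2 * t `^ alpha.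
  exact: x0.
(* Averaging over [[0, d / 2]] keeps all positive times strictly below [d]. A single mean suffices,
   as [p] and [e] are fixed. *)
have d20 : 0 < d / 2 by rewrite divr_gt0.
have [y xy] := orbit_average_cvg x (ltW d20).
have /X_spaceP[_ /(_ p Pp _ e20)] : X_space j T alpha y.
  apply: generator_domain_X_space; eexists.
  exact: (orbit_mean_generator d20 xy).
have : \forall t \near (0 : R)^'+, 0 < t by exact: nbhs_right_gt.
apply: filterS2 => t t0 ty.
have := orbit_mean_distance (B := e / 2 * t `^ alpha) xy Pp (ltW d20) (ltW t0).
(* The first term is small because [y] lies in X_alpha, the second because [y] is close to [x] in
   the seminorm p_F. *)
have -> : T t x - x = (T t y - y) - (T t (y - x) - (y - x)).
  have -> : T t (y - x) - (y - x) = T t y - y - (T t x - x).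
    by rewrite [T t (y - x)]linearB /= !opprD !opprK addrACA.
  by rewrite subKr.
move=> yx; apply: le_trans (seminormB pP _ _) _.
rewrite [e]splitr mulrDl lerD//; apply: yx.
  by rewrite mulr_ge0 ?powR_ge0// ltW.
(* Time 0 is treated apart, since the limit at [0^'+] says nothing about it. *)
move=> r /andP[]; rewrite le_eqVlt => /orP[/eqP<- _|r0 rd].
  rewrite (sg_0 TP) subrr linear0 subrr (seminorm0 pP).
  by rewrite mulr_ge0 ?powR_ge0// ltW.
by apply: dx => //; rewrite r0; lra.
Qed.

End Holder.
End Semigroup.

Unset Implicit Arguments.
Set Strict Implicit.
Set Printing Implicit Defensive.

Theorem theorem4p21 (R : realType) (c : scalar_kind)
    (X : completeNormedModType (scalars R c)) (Xtau : tvsType (scalars R c))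
    (j : {linear X -> Xtau}) (P : set (X -> R))
    (T : R -> {linear X -> X}) (alpha : R) :
  assumption_S j -> defining_seminorms j P ->
  bicontinuous_semigroup j T -> negative_growth_bound T ->
  0 < alpha < 1 ->
  [/\ tauF_bidense T alpha P (generator_domain j T) (X_space j T alpha),
      X_space j T alpha =
        [set x | F_space T alpha x /\
          (fun t : R => T t x) @ 0^'+ `=>` tauF_nbhs T alpha P x] &
      forall x, F_space T alpha x ->
        (tauF_orbit_continuous T alpha P x <-> X_space j T alpha x)].
Proof.
move=> jS jP TP [M [omega [M1 omega0 TM]]] alpha01.
(* These three implications form a cycle: membership in X_alpha, continuity of the whole orbit,
   convergence at 0. *)
have cvg0X x := tauF_cvg0_X_space jS jP TP M1 omega0 TM alpha01 (x := x).
have Xcvg x := X_space_tauF_orbit_continuous jS jP TP M1 omega0 TM alpha01 (x := x).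
have cvg0 x := tauF_orbit_continuous_cvg0 TP (P := P) (alpha := alpha) (x := x).
split.
- exact: (X_space_bidense jS jP TP M1 omega0 TM alpha01).
- apply/seteqP; split=> x /=; last by case; exact: cvg0X.
  by move=> xX; split; [case: xX|exact/cvg0/Xcvg].
- by move=> x xF; split=> [/cvg0|]; [exact: cvg0X|exact: Xcvg].
Qed.
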